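(* Let $X$ be a real Banach space with continuous dual $X^*$. Let $A\colon X\rightrightarrows X^*$ be maximal monotone of type (FPV), and let $B\colon X\rightrightarrows X^*$ be maximal monotone with full domain (i.e. $\operatorname{dom} B=X$). Then $A+B$ is maximal monotone.
   Context: $X$ is a real Banach space, $X^*$ its continuous dual, and $\langle x,x^*\rangle$ denotes the duality pairing. A set-valued operator $A\colon X\rightrightarrows X^*$ assigns to each $x\in X$ a subset $Ax\subseteq X^*$; its graph is $\operatorname{gra} A=\{(x,x^* )\in X\times X^*\mid x^*\in Ax\}$ and its domain is $\operatorname{dom} A=\{x\in X\mid Ax\neq\varnothing\}$. $A$ is monotone if $\langle x-y,x^*-y^*\rangle\geq 0$ for all $(x,x^* ),(y,y^* )\in\operatorname{gra} A$; it is maximal monotone if it is monotone and its graph is not properly contained in the graph of another monotone operator. The sum $A+B$ is defined by $(A+B)x=\{a^*+b^*\mid a^*\in Ax,\ b^*\in Bx\}$. A maximal monotone operator $A\colon X\rightrightarrows X^*$ is of type (FPV) if for every open convex set $U\subseteq X$ with $U\cap\operatorname{dom} A\neq\varnothing$ the following holds: whenever $x\in U$ and $x^*\in X^*$ satisfy $\langle x-y,x^*-y^*\rangle\geq 0$ for all $(y,y^* )\in\operatorname{gra} A\cap (U\times X^* )$, then $(x,x^* )\in\operatorname{gra} A$. *)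

(* Defs.v *)
From HB Require Import structures.
From mathcomp Require Import all_boot all_order all_algebra.
From mathcomp Require Import all_classical all_reals all_analysis.

Set Implicit Arguments.
Unset Strict Implicit.
Unset Printing Implicit Defensive.

Import Order.TTheory GRing.Theory Num.Theory.
Import numFieldNormedType.Exports.

Local Open Scope classical_set_scope.
Local Open Scope ring_scope.

(** The continuous dual [X^*], as the subspace of the continuous linear forms
    in the vector space of all functions [X -> R^o]. [R^o] is [R] viewed as a
    normed space over itself. *)

Definition cont_linear_form (R : realType) (X : normedModType R) :
    {pred X -> R^o} :=
  mem [set f : X -> R^o | linear f /\ continuous f].
Arguments cont_linear_form {R X}.

Section cont_linear_form_submod.
Context {R : realType} {X : normedModType R}.

Lemma cont_linear_formP (f : X -> R^o) :
  f \in cont_linear_form <-> linear f /\ continuous f.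
Proof. by split=> [/set_mem|?]; last exact/mem_set. Qed.

Lemma cont_linear_form_submod_closed :
  submod_closed (@cont_linear_form R X).
Proof.
split=> [|a f g /cont_linear_formP[lf cf] /cont_linear_formP[lg cg]].
  apply/cont_linear_formP; split=> [b x y|x]; last exact: cvg_cst.
  by rewrite -![(0 : X -> R^o) _]/(0 : R^o) scaler0 addr0.
apply/cont_linear_formP; split=> [b x y|x].
  rewrite -[LHS]/(a *: f (b *: x + y) + g (b *: x + y)) lf lg.
  rewrite -[RHS]/(b *: (a *: f x + g x) + (a *: f y + g y)).
  by rewrite !scalerDr !scalerA [a * b]mulrC addrACA.
by apply: cvgD; [apply: cvgZr; exact: cf|exact: cg].
Qed.

HB.instance Definition _ :=
  GRing.isSubmodClosed.Build R (X -> R^o) cont_linear_form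
    cont_linear_form_submod_closed.

End cont_linear_form_submod.

Record dual (R : realType) (X : normedModType R) := Dual {
  dual_fun :> X -> R^o;
  dual_funP : dual_fun \in cont_linear_form
}.

Section dual_lmodType.
Context {R : realType} {X : normedModType R}.

HB.instance Definition _ := [isSub of dual X for @dual_fun R X].
HB.instance Definition _ := [Choice of dual X by <:].
HB.instance Definition _ := [SubChoice_isSubLmodule of dual X by <:].

Lemma dual_linear (f : dual X) : linear f.
Proof. by case/cont_linear_formP: (dual_funP f). Qed.

Lemma dual_continuous (f : dual X) : continuous f.
Proof. by case/cont_linear_formP: (dual_funP f). Qed.

HB.instance Definition _ (f : dual X) :=
  GRing.isLinear.Build R X R^o *:%R f (dual_linear f).

Lemma dualD (f g : dual X) (x : X) : (f + g) x = f x + g x.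
Proof. by []. Qed.

Lemma dualN (f : dual X) (x : X) : (- f) x = - f x.
Proof. by []. Qed.

Lemma dualZ (a : R) (f : dual X) (x : X) : (a *: f) x = a * f x.
Proof. by []. Qed.

End dual_lmodType.

Definition pairing (R : realType) (X : normedModType R) (x : X) (x' : dual X)
  : R := x' x.

Section set_valued_operators.
Context {R : realType} {X : normedModType R}.
Implicit Types A B : X -> set (dual X).

Definition gra A : set (X * dual X) := [set p | A p.1 p.2].

Definition dom A : set X := [set x | A x !=set0].

Definition monotone A : Prop :=
  forall (x y : X) (x' y' : dual X),
    gra A (x, x') -> gra A (y, y') -> 0 <= pairing (x - y) (x' - y').

Definition maximal_monotone A : Prop :=
  monotone A /\ forall B, monotone B -> ~ (gra A `<` gra B).

Definition op_add A B : X -> set (dual X) :=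
  fun x => [set a' + b' | a' in A x & b' in B x].

Definition type_FPV A : Prop :=
  forall U : set X, open U -> @convex_set R X U -> U `&` dom A !=set0 ->
  forall (x : X) (x' : dual X), U x ->
    (forall (y : X) (y' : dual X), (gra A `&` (U `*` [set: dual X])) (y, y') ->
       0 <= pairing (x - y) (x' - y')) ->
    gra A (x, x').

End set_valued_operators.

(* Main.v *)
From HB Require Import structures.
Require Import Defs.
From mathcomp Require Import all_boot all_order all_algebra ring lra.
From mathcomp Require Import all_classical all_reals all_analysis.
Set Implicit Arguments.
Unset Strict Implicit.
Unset Printing Implicit Defensive.
Import Order.TTheory GRing.Theory Num.Theory.
Import numFieldNormedType.Exports.

Local Open Scope classical_set_scope.
Local Open Scope ring_scope.

(** Translate so that the pair [(z, z')] monotonically related to [A + B] is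
    [(0, 0)]. One then needs [c] in the dual with [- c] in [A 0] and [c] in
    [B 0], that is [- a u <= c u] and [- b w <= c (- w)] on the two graphs. By a
    Hahn-Banach argument on convex cones in [X * R], it suffices that the cone
    generated by the pairs [(u, - a u)] and [(- w, - b w)] lies below
    [M * `|x|], where [M] bounds [B] near [0]. For this, take [b0] in
    [B (t *: y)] and apply type (FPV) at [(t *: y, - b0)] in the tube of radius
    [t ^ 2] around the segment from [0] to [t *: y]; as [t] goes to [0], the
    terms of order [t] give the required inequality. The tube meets [dom A]
    because [0] is in the closure of [dom A], by another use of type (FPV) in a
    tube on which [B] is bounded. *)

(** * Hahn-Banach extension for convex cones in [X * R] *)

Section cone_extension.
Context {R : realType} {X : normedModType R}.

Definition convex_cone (D : set (X * R^o)) : Prop :=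
  [/\ D 0, forall p q, D p -> D q -> D (p + q) &
      forall (k : R) p, 0 <= k -> D p -> D (k *: p)].

Lemma dual_normP (f : dual X) :
  exists2 C, 0 <= C & forall x, `|f x| <= C * `|x|.
Proof.
have /linear_bounded_continuous/linear_boundedP/pinfty_ex_gt0[C C0 fC] :=
  @dual_continuous _ _ f.
by exists C => //; exact: ltW.
Qed.

Lemma dual_of_bound (f : X -> R) (M : R) :
  (forall x y, f (x + y) = f x + f y) ->
  (forall k x, f (k *: x) = k * f x) ->
  (forall x, `|f x| <= M * `|x|) -> exists c : dual X, forall x, c x = f x.
Proof.
move=> fD fZ fM.
have lf : linear (f : X -> R^o) by move=> k x y; rewrite fD fZ.
pose g : {linear X -> R^o} := HB.pack f (GRing.isLinear.Build _ _ _ _ _ lf).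
have cf : continuous (f : X -> R^o).
  apply: (@linear_bounded_continuous _ _ _ g).1.
  apply/linear_boundedP; exists M; split; first exact: num_real.
  by move=> r Mr x; rewrite (le_trans (fM x))// ler_wpM2r// ltW.
have fP : (f : X -> R^o) \in cont_linear_form by apply/cont_linear_formP.
by exists (Dual fP).
Qed.

(** Zorn's lemma gives a maximal dominated cone [D]. If every [d + p] is dominated, so is every
    [d + k *: p] with [0 < k], by rescaling [d] to [k^-1 *: d]. Hence adjoining the ray of [p] keeps
    a dominated cone, and maximality forces [p] into [D]. *)
Lemma maximal_dominated_cone (M : R) (D0 : set (X * R^o)) :
  convex_cone D0 -> (forall p, D0 p -> p.2 <= M * `|p.1|) ->
  exists D, [/\ D0 `<=` D, convex_cone D, forall p, D p -> p.2 <= M * `|p.1| &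
    forall p, (forall d, D d -> d.2 + p.2 <= M * `|d.1 + p.1|) -> D p].
Proof.
move=> cD0 D0M.
pose P D := [/\ D0 `<=` D, convex_cone D & forall p, D p -> p.2 <= M * `|p.1|].
(* The alternative [D = set0] is there for the empty chain, whose union is empty and does not
   contain [D0]. *)
have [F FP Ftot|D [PD Dmax]] := @Zorn_bigcup _ [set D | D = set0 \/ P D].
  have [[Y [FY PY]]|noP] := pselect (exists Y, F Y /\ P Y); last first.
    left; apply/seteqP; split => // p [Z FZ Zp].
    by case: (FP _ FZ) => [Z0|PZ]; [rewrite Z0 in Zp|case: noP; exists Z].
  right; case: (PY) => D0Y [Y0 _ _] _.
  have up p q : (\bigcup_(Z in F) Z) p -> (\bigcup_(Z in F) Z) q ->
      exists Z, [/\ F Z, P Z, Z p & Z q].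
    move=> [Z FZ Zp] [W FW Wq].
    have Pn V v : F V -> V v -> P V.
      by move=> FV Vv; case: (FP _ FV) => // V0; rewrite V0 in Vv.
    have [ZW|WZ] := Ftot _ _ FZ FW.
      by exists W; split => //; [exact: Pn Wq|exact: ZW].
    by exists Z; split => //; [exact: Pn Zp|exact: WZ].
  split; first by move=> p D0p; exists Y => //; exact: D0Y.
    split; first by exists Y.
      move=> p q /up/[apply] -[Z [FZ [_ [_ ZD _] _] Zp Zq]].
      by exists Z => //; exact: ZD.
    move=> k p k0 Up; have [Z [FZ [_ [_ _ ZZ] _] Zp _]] := up _ _ Up Up.
    by exists Z => //; exact: ZZ.
  move=> p Up; have [Z [FZ [_ _ ZM] Zp _]] := up _ _ Up Up; exact: ZM.
have PD0 : P D0 by split.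
have {}PD : P D.
  case: PD => // D_0; exfalso; apply: (Dmax D0); last by right.
  rewrite D_0; split => // sD0; apply: (sD0 0); by case: cD0.
exists D; case: (PD) => D0D [D00 DD DZ] DM; split => // p hp.
apply: contrapT => nDp.
pose E := [set q : X * R^o | exists2 d, D d & exists2 k : R, 0 <= k & q = d + k *: p].
apply: (Dmax E); first split.
- by move=> d Dd; exists d => //; exists 0; rewrite ?scale0r ?addr0.
- by move=> ED; apply/nDp/ED; exists 0 => //; exists 1; rewrite ?scale1r ?add0r.
right; split.
- by move=> d /D0D Dd; exists d => //; exists 0; rewrite ?scale0r ?addr0.
- split; first by exists 0 => //; exists 0; rewrite ?scale0r ?addr0.
    move=> _ _ [d Dd [k k0 ->]] [d' Dd' [k' k'0 ->]].
    exists (d + d'); first exact: DD.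
    by exists (k + k'); rewrite ?addr_ge0// scalerDl addrACA.
  move=> l _ l0 [d Dd [k k0 ->]]; exists (l *: d); first exact: DZ.
  by exists (l * k); rewrite ?mulr_ge0// scalerDr scalerA.
- move=> _ [d Dd [k k0 ->]].
  have [->|kn0] := eqVneq k 0; first by rewrite scale0r addr0; exact: DM.
  have kp : 0 < k by rewrite lt_neqAle eq_sym kn0.
  have /hp : D (k^-1 *: d) by apply: DZ => //; rewrite invr_ge0.
  rewrite -(ler_pM2l kp) /= mulrDr mulrA divff// mul1r.
  move=> /le_trans; apply; rewrite mulrCA -[X in X * `|_|](ger0_norm k0) -normrZ.
  by rewrite scalerDr scalerA divff// scale1r.
Qed.

(* A maximal cone below [M * `|x|] is the hypograph of
   [q x = inf_(d in D) M * `|d.1 + x| - d.2]; [q] is subadditive by this formula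
   and superadditive because its hypograph is a cone. *)
Lemma cone_extension (M : R) (D0 : set (X * R^o)) :
  0 <= M -> convex_cone D0 -> (forall p, D0 p -> p.2 <= M * `|p.1|) ->
  exists2 c : dual X, (forall x, `|c x| <= M * `|x|) &
    forall p, D0 p -> p.2 <= c p.1.
Proof.
move=> M0 cD0 /(maximal_dominated_cone cD0)[D [D0D [D00 DD DZ] DM Dmax]].
pose V x := [set M * `|d.1 + x| - d.2 | d in D].
pose q x : R := inf (V x).
have Vlb x : lbound (V x) (- (M * `|x|)).
  move=> _ [d Dd <-]; have := DM _ Dd.
  have : M * `|d.1| <= M * `|d.1 + x| + M * `|x|.
    rewrite -mulrDr ler_wpM2l// -[in leLHS](addrK x d.1).
    by rewrite (le_trans (ler_normD _ _)) ?normrN.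
  lra.
have Vinf x : has_inf (V x).
  by split; [exists (M * `|0 + x| - 0); exists 0|exists (- (M * `|x|)); exact: Vlb].
have qle x d : D d -> q x <= M * `|d.1 + x| - d.2.
  by move=> Dd; apply: ge_inf; [case: (Vinf x)|exists d].
have qge x r : (forall d, D d -> r <= M * `|d.1 + x| - d.2) -> r <= q x.
  move=> h; apply: lb_le_inf; first by case: (Vinf x).
  by move=> _ [d Dd <-]; exact: h.
have Dq x : D (x, q x).
  by apply: Dmax => d Dd /=; have := qle x _ Dd; lra.
have qD0 x r : D (x, r) -> r <= q x.
  move=> Dx; apply: qge => d Dd; have /= := DM _ (DD _ _ Dd Dx); lra.
have qD x y : q (x + y) = q x + q y.
  apply/eqP; rewrite eq_le; apply/andP; split; last by apply: qD0; exact: DD (Dq x) (Dq y).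
  rewrite -lerBlDr; apply/qge => d Dd; rewrite lerBlDr -lerBlDl.
  apply/qge => e De; rewrite lerBlDr.
  apply: le_trans (qle _ _ (DD _ _ De Dd)) _ => /=.
  have : M * `|e.1 + d.1 + (x + y)| <= M * `|e.1 + y| + M * `|d.1 + x|.
    by rewrite -mulrDr ler_wpM2l// [x + y]addrC addrACA ler_normD.
  lra.
have q0 : q 0 = 0 by have := qD 0 0; rewrite addr0; lra.
have qN x : q (- x) = - q x by have := qD x (- x); rewrite subrr q0; lra.
have qZ0 k x : 0 <= k -> q (k *: x) = k * q x.
  move=> k0; have h y : k * q y <= q (k *: y) by apply: qD0; exact: DZ (Dq y).
  by apply/eqP; rewrite eq_le h andbT; have := h (- x); rewrite scalerN !qN mulrN lerN2.
have qZ k x : q (k *: x) = k * q x.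
  have [k0|k0] := leP 0 k; first exact: qZ0.
  by rewrite -[k]opprK scaleNr qN qZ0 ?mulNr// oppr_ge0 ltW.
have qM x : `|q x| <= M * `|x|.
  have h y : q y <= M * `|y| by have := qle y _ D00; rewrite add0r subr0.
  by rewrite ler_norml h andbT; have := h (- x); rewrite qN normrN lerNl.
have [c cE] := dual_of_bound qD qZ qM.
exists c => [x|[x r] /D0D /qD0]; by rewrite cE.
Qed.

(** The ray through [y] paired with its norm lies on the graph of the norm, so it extends with
    [M = 1]. *)
Lemma norming_functional (y : X) :
  exists2 f : dual X, (forall x, `|f x| <= `|x|) & f y = `|y|.
Proof.
pose D := [set p : X * R^o | exists2 k : R, 0 <= k & p = k *: (y, `|y|)].
have cD : convex_cone D.
  split; first by exists 0; rewrite ?scale0r.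
    move=> _ _ [k k0 ->] [l l0 ->].
    by exists (k + l); rewrite ?addr_ge0// scalerDl.
  by move=> l _ l0 [k k0 ->]; exists (l * k); rewrite ?mulr_ge0// scalerA.
have [|f f1 fD] := @cone_extension 1 D ler01 cD.
  by move=> _ [k k0 ->] /=; rewrite mul1r normrZ ger0_norm.
have {}f1 x : `|f x| <= `|x| by rewrite -[leRHS]mul1r.
exists f => //; apply/eqP; rewrite eq_le (le_trans (ler_norm _) (f1 y))/=.
by apply: (fD (y, `|y|)); exists 1; rewrite ?scale1r.
Qed.

End cone_extension.

(** * Open convex tubes around a segment *)

Section tube.
Context {R : realType} {X : normedModType R}.

Lemma convex_setE (U : set X) :
  @convex_set R X U <-> forall x y (l : R), 0 <= l <= 1 -> U x -> U y ->
    U (l *: x + (1 - l) *: y).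
Proof.
split=> [cU x y l l01 Ux Uy|cU x y l /set_mem Ux /set_mem Uy].
  have il : Itv.spec (@Itv.num_sem R) (Itv.Real `[0%Z, 1%Z]) l.
    by rewrite /= /Itv.num_sem/= in_itv/= num_real.
  by apply/set_mem; apply: (cU x y (Itv.mk il)); exact/mem_set.
by apply/mem_set; apply: cU => //; rewrite ge0 le1.
Qed.

Definition tube (y : X) (r : R) : set X :=
  [set v | exists2 s : R, 0 <= s <= 1 & `|v - s *: y| < r].

Lemma tube_open y r : open (tube y r).
Proof.
rewrite openE => v [s s01 vr]; apply/nbhs_ballP.
exists (r - `|v - s *: y|); first by rewrite /= subr_gt0.
move=> w; rewrite -ball_normE /= => vw; exists s => //.
rewrite -[w](addrNK v) -addrA (le_lt_trans (ler_normD _ _))// -ltrBrDr.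
by rewrite distrC.
Qed.

Lemma tube_convex y r : @convex_set R X (tube y r).
Proof.
apply/convex_setE => v w l /andP[l0 l1] [s /andP[s0 s1] vr] [t /andP[t0 t1] wr].
exists (l * s + (1 - l) * t); first by apply/andP; split; nra.
have -> : l *: v + (1 - l) *: w - (l * s + (1 - l) * t) *: y =
    l *: (v - s *: y) + (1 - l) *: (w - t *: y).
  by rewrite !scalerBr !scalerA [(l * s + _) *: y]scalerDl opprD addrACA.
apply: (le_lt_trans (ler_normD _ _)); rewrite !normrZ ger0_norm//.
rewrite ger0_norm ?subr_ge0//; set p := `|v - _| in vr *; set q := `|w - _| in wr *.
have [pq|/ltW qp] := leP p q.
  apply: le_lt_trans wr; rewrite [leRHS](_ : q = l * q + (1 - l) * q); last by ring.
  by rewrite lerD2r ler_wpM2l.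
apply: le_lt_trans vr; rewrite [leRHS](_ : p = l * p + (1 - l) * p); last by ring.
by rewrite lerD2l ler_wpM2l// subr_ge0.
Qed.

End tube.

(** * Type (FPV): witnesses and translation *)

Section FPV.
Context {R : realType} {X : normedModType R}.
Implicit Types A B : X -> set (dual X).

Lemma pairing_addl (f : dual X) x y : f (x + y) = (f x : R) + f y.
Proof. exact: linearD. Qed.

Lemma pairing_subl (f : dual X) x y : f (x - y) = (f x : R) - f y.
Proof. exact: linearB. Qed.

Lemma pairing_scalel (f : dual X) k x : f (k *: x) = k * f x.
Proof. exact: linearZ. Qed.

Lemma pairingBr x (f g : dual X) : pairing x (f - g) = f x - g x.
Proof. by []. Qed.

Lemma monotoneP B u v (b c : dual X) :
  Defs.monotone B -> B u b -> B v c -> b (v - u) <= c (v - u).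
Proof.
move=> mB Bb Bc; have := mB u v b c Bb Bc.
by rewrite pairingBr -[u - v]opprB !linearN /=; lra.
Qed.

Lemma dual_scale_le (b : dual X) (K t : R) :
  0 <= t -> (forall x, `|x| <= 1 -> `|b x| <= K * t) ->
  forall x, `|b x| <= K * t * `|x|.
Proof.
move=> t0 bK x; have [->|x0] := eqVneq x 0; first by rewrite linear0 !normr0 mulr0.
have xp : 0 < `|x| by rewrite normr_gt0.
have := bK (`|x|^-1 *: x); rewrite normrZ linearZ normrM normfV normr_id.
rewrite mulVf ?gt_eqF// => /(_ (lexx _)); rewrite mulrC ler_pdivrMr//.
Qed.

(** If no pair over [U] satisfied the inequality, [(x, x')] would be monotonically related to the
    part of [A] over [U]. Type (FPV) would then put it in the graph of [A], where it is itself a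
    witness. *)
Lemma FPV_witness A (U : set X) x (x' : dual X) :
  type_FPV A -> open U -> @convex_set R X U -> U `&` dom A !=set0 -> U x ->
  exists u a, [/\ U u, A u a & x' (x - u) <= a (x - u)].
Proof.
move=> FA oU cU UA Ux; apply: contrapT => h.
have Axx' : A x x'.
  apply: (FA U oU cU UA x x' Ux) => u a [/= Aua [Uu _]].
  rewrite -[leRHS]/(x' (x - u) - a (x - u)) subr_ge0 leNgt.
  by apply/negP => lt_ax; apply: h; exists u, a; split => //; exact: ltW.
by apply: h; exists x, x'; split.
Qed.

Lemma type_FPV_translate A z : type_FPV A -> type_FPV (fun u => A (z + u)).
Proof.
move=> FA U oU cU [u [Uu [a Aa]]] x x' Ux h.
pose V := (fun v => v - z) @^-1` U.
have VE v : V (z + v) = U v by rewrite /V /= [z + v]addrC addrK.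
have oV : open V.
  apply: open_comp => // v _; apply: cvgB; [exact: cvg_id|exact: cvg_cst].
have cV : @convex_set R X V.
  apply/convex_setE => v w l l01 Vv Vw; rewrite /V /=.
  have := (convex_setE U).1 cU (v - z) (w - z) l l01 Vv Vw.
  by rewrite !scalerBr addrACA -opprD -scalerDl subrKC scale1r.
have VA : V `&` dom A !=set0 by exists (z + u); split; [rewrite VE|exists a].
apply: (FA V oV cV VA); first by rewrite VE.
move=> y y' [Ay [Vy _]]; have := h (y - z) y'; rewrite /pairing opprB addrCA.
rewrite -addrA; apply; split=> //=; by rewrite /gra/= addrCA subrr addr0.
Qed.

End FPV.

(** * Uniform bounds on a monotone operator along a segment *)

Section tube_bounded.
Context {R : realType} {X : completeNormedModType R}.
Implicit Type B : X -> set (dual X).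

(* The values [b] near [s *: y] are bounded at [x] by monotonicity against the
   values of [B] at [x] and [x + y], up to the term [b e]. Normalizing by
   [1 + `|b e|] makes them pointwise bounded; the uniform bound so obtained
   absorbs [b e] as soon as [e] is small. *)
Lemma tube_bounded B (y : X) : Defs.monotone B -> dom B = [set: X] ->
  exists2 r, 0 < r & exists2 M, 0 <= M & forall u b, tube y r u -> B u b ->
    forall x, `|b x| <= M * `|x|.
Proof.
move=> mB dB.
have BP x : exists c, B x c by have : dom B x by rewrite dB.
pose F : set (X -> R^o) := [set f | exists u b s, [/\ B u b, 0 <= s <= 1,
  `|u - s *: y| <= 1 & f = (fun x => (1 + `|b (u - s *: y)|)^-1 * b x)]].
have t_gt0 (b : dual X) e : 0 < 1 + `|b e| by have := normr_ge0 (b e); lra.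
have Fl f : F f -> bounded_fun_norm f /\ linear f.
  move=> [u [b [s [Bb s01 us ->]]]]; split.
    have [C C0 bC] := dual_normP b.
    move=> r; exists ((1 + `|b (u - s *: y)|)^-1 * (C * r)) => x xr.
    rewrite normrM gtr0_norm ?invr_gt0// ler_pM2l ?invr_gt0//.
    by apply: le_trans (bC x) _; rewrite ler_wpM2l.
  by move=> k v w; rewrite [b (_ + w)]pairing_addl pairing_scalel mulrDr mulrCA.
have ub x : exists2 C, 0 <= C & forall f, F f -> f x <= C.
  have [c0 Bc0] := BP x; have [c1 Bc1] := BP (x + y).
  have [C0 C00 c0C] := dual_normP c0; have [C1 C10 c1C] := dual_normP c1.
  pose N := `|x| + `|y| + 1.
  have N0 : 0 <= N by rewrite !addr_ge0.
  exists ((C0 + C1) * N + 1); first by rewrite addr_ge0// mulr_ge0// addr_ge0.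
  move=> _ [u [b [s [Bb /andP[s0 s1] us ->]]]].
  set e := u - s *: y in us *; have uE : u = s *: y + e by rewrite addrC subrK.
  clearbody e.
  rewrite mulrC ler_pdivrMr//.
  have h0 : b (x - u) <= C0 * N.
    apply: le_trans (monotoneP mB Bb Bc0) _.
    apply: le_trans (ler_norm _) _; apply: le_trans (c0C _) _.
    rewrite ler_wpM2l// uE opprD addrA.
    rewrite (le_trans (ler_normB _ _))// lerD// (le_trans (ler_normB _ _))// lerD//.
    by rewrite normrZ ger0_norm// ler_piMl.
  have h1 : b (x + y - u) <= C1 * N.
    apply: le_trans (monotoneP mB Bb Bc1) _.
    apply: le_trans (ler_norm _) _; apply: le_trans (c1C _) _.
    have -> : x + y - u = x + (1 - s) *: y - e.
      by rewrite uE scalerBl scale1r opprD !addrA.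
    rewrite ler_wpM2l// (le_trans (ler_normB _ _))// lerD//.
    rewrite (le_trans (ler_normD _ _))// lerD// normrZ ger0_norm ?subr_ge0//.
    by rewrite ler_piMl//; lra.
  move: h0 h1; rewrite uE !(pairing_subl, pairing_addl, pairing_scalel) => h0 h1.
  (* Weights [1 - s] on [h0] and [s] on [h1] cancel the uncontrolled term in [b y], because [(1 - s)
     *: (x - u) + s *: (x + y - u) = x - e]. *)
  have : b x - b e <= (C0 + C1) * N.
    have := mulr_ge0 C00 N0; have := mulr_ge0 C10 N0; rewrite mulrDl.
    move: (C0 * N) (C1 * N) h0 h1 => P Q h0 h1 Q0 P0.
    have := ler_wpM2l s0 h1; have s1' : 0 <= 1 - s by rewrite subr_ge0.
    have := ler_wpM2l s1' h0; have := mulr_ge0 s1' Q0; have := mulr_ge0 s0 P0.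
    lra.
  have := ler_norm (b e); have := normr_ge0 (b e).
  have : 0 <= (C0 + C1) * N by rewrite mulr_ge0// addr_ge0.
  by move: ((C0 + C1) * N) `|b e| => Z t Z0 t0; have := mulr_ge0 Z0 t0; lra.
have [|K FK] := @Banach_Steinhauss _ _ _ F Fl _ 1.
  move=> x; have [C C0 hC] := ub x; have [D D0 hD] := ub (- x).
  exists (C + D) => f Ff; have [_ lf] := Fl f Ff.
  have fN : f (- x) = - f x.
    by have := lf (-1) x (- x + x); rewrite scaleN1r addNr addr0 => ->;
      have := lf (-1) 0 0; rewrite scaler0 addr0 scaleN1r addNr => ->; rewrite addr0 scaleN1r.
  by rewrite ler_norml; have := hC f Ff; have := hD f Ff; rewrite fN; lra.
pose K' := Num.max K 1.
have K'1 : 1 <= K' by rewrite le_max lexx orbT.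
(* With this radius, [K'] times the norm of [e = u - s *: y] is at most 1/2. So [t], the absolute
   value of [b e], satisfies [t <= (1 + t) / 2], that is [t <= 1], and the bound [K' * (1 + t)]
   becomes [2 * K']. *)
have r0 : 0 < (2 * K')^-1 by rewrite invr_gt0; lra.
exists (2 * K')^-1 => //.
exists (2 * K'); first by lra.
move=> u b [s s01 us] Bb.
have bK x : `|b x| <= K' * (1 + `|b (u - s *: y)|) * `|x|.
  apply: dual_scale_le => [|{}x x1]; first exact/ltW/t_gt0.
  have us1 : `|u - s *: y| <= 1.
    by rewrite (le_trans (ltW us))// invf_le1; lra.
  have : F (fun x => (1 + `|b (u - s *: y)|)^-1 * b x) by exists u, b, s.
  move=> /FK/(_ x x1); rewrite normrM gtr0_norm ?invr_gt0// mulrC ler_pdivrMr//.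
  move=> /le_trans; apply; rewrite ler_pM2r//.
  by rewrite /K' le_max lexx.
have h : `|b (u - s *: y)| <= 1.
  have := bK (u - s *: y); set t := `|b _|; set d := `|_ - _| => td.
  have : K' * d <= 2^-1.
    by move: us; rewrite -/d -div1r ltr_pdivlMr; lra.
  have := normr_ge0 (b (u - s *: y)); rewrite -/t => t0 Kd.
  have : (1 + t) * (K' * d) <= (1 + t) * 2^-1 by rewrite ler_wpM2l//; lra.
  nra.
move=> x; apply: le_trans (bK x) _; rewrite ler_wpM2r//.
by rewrite mulrC ler_wpM2r//; lra.
Qed.

End tube_bounded.

(** * Fitzpatrick cones projected to [X * R] *)

Section fitzpatrick_cone.
Context {R : realType} {X : normedModType R}.
Implicit Types A B : X -> set (dual X).

(* The cone generated by the epigraph of the Fitzpatrick function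
   [(x, x') |-> sup_((u, a) in gra A) (a x + x' u - a u)], with [x'] projected
   out. *)
Definition fitzpatrick_cone A : set (X * R^o) :=
  [set p | exists2 L : R, 0 <= L & exists x' : dual X,
    forall u a, A u a -> (a p.1 : R) + x' u - L * a u <= p.2].

Lemma fitzpatrick_cone_convex A : convex_cone (fitzpatrick_cone A).
Proof.
split.
- exists 0 => //; exists 0 => u a _ /=.
  by rewrite linear0 add0r mul0r subr0.
- move=> p q [L L0 [x' hp]] [K K0 [y' hq]].
  exists (L + K); first exact: addr_ge0.
  exists (x' + y') => u a Aua; rewrite dualD /= pairing_addl mulrDl.
  by have := hp u a Aua; have := hq u a Aua; move: p.2 q.2 => /= p2 q2; lra.
- move=> k p k0 [L L0 [x' hp]]; exists (k * L); first exact: mulr_ge0.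
  exists (k *: x') => u a Aua; rewrite dualZ /= pairing_scalel -mulrA -mulrDr.
  by rewrite -mulrBr /GRing.scale/= ler_wpM2l// hp.
Qed.

(** On the graph of a monotone operator the Fitzpatrick function equals the pairing [a u], so
    [L = 1] and [x' = a] serve. *)
Lemma gra_fitzpatrick_cone A u a :
  Defs.monotone A -> A u a -> fitzpatrick_cone A (u, a u : R^o).
Proof.
move=> mA Aua; exists 1 => //; exists a => v c Avc /=.
by have := monotoneP mA Avc Aua; rewrite !pairing_subl mul1r; lra.
Qed.

Lemma ge0_of_small (a Q t0 : R) :
  0 < t0 -> (forall t, 0 < t -> t <= t0 -> 0 <= a + t * Q) -> 0 <= a.
Proof.
move=> t00 h; rewrite leNgt; apply/negP => a0.
have Q0 : 0 < `|Q| + 1 by rewrite ltr_wpDl.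
pose t := Num.min t0 (- a / (2 * (`|Q| + 1))).
have t_gt0 : 0 < t by rewrite lt_min t00 divr_gt0 ?oppr_gt0// mulr_gt0.
have : 0 <= a + t * Q by apply: h => //; rewrite ge_min lexx.
have : t * (2 * (`|Q| + 1)) <= - a.
  by rewrite -ler_pdivlMr ?mulr_gt0// ge_min lexx orbT.
have := ler_wpM2l (ltW t_gt0) (ler_norm Q); lra.
Qed.

End fitzpatrick_cone.

(** * A functional separating [A] and [B] at the origin *)

Section sum.
Context {R : realType} {X : completeNormedModType R}.
Variables A B : X -> set (dual X).
Hypotheses (FA : type_FPV A) (mA : Defs.monotone A) (A0 : dom A !=set0).
Hypotheses (mB : Defs.monotone B) (dB : dom B = [set: X]).
Hypothesis AB : forall u a b, A u a -> B u b -> 0 <= (a u : R) + b u.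

Let BP x : exists b, B x b. Proof. by have : dom B x by rewrite dB. Qed.

(** Type (FPV) at 0 with [- (M + 1) *: f], where [f] norms [y], gives
    [(M + 1) * f u <= - a u <= b u], which is at most [M] times the norm of [u]. In a thin tube
    [f u] nearly equals that norm, so the slope [M + 1] against [M] forces [u] to be small. *)
Lemma zero_closure_dom (r : R) : 0 < r -> exists u a, `|u| < r /\ A u a.
Proof.
move=> r0; have [y [a0 Aa0]] := A0.
have [r1 r10 [M M0 bM]] := tube_bounded y mB dB.
have [f f1 fy] := norming_functional y.
have K0 : 0 < 2 * M + 2 by lra.
(* The first entry keeps the bound [M] valid on the tube. The argument yields that the norm of [u]
   is at most [2 * M + 2] times that of its offset [e], hence the second. *)
pose p := Num.min r1 (r / (2 * M + 2)).
have p0 : 0 < p by rewrite lt_min r10 divr_gt0.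
have [||u [a [[s /andP[s0 s1] us] Aua]]] := @FPV_witness _ _ A (tube y p) 0
    (- (M + 1) *: f) FA (@tube_open _ _ y p) (@tube_convex _ _ y p).
- exists y; split; last by exists a0.
  by exists 1; rewrite ?scale1r ?subrr ?normr0 ?lexx ?ler01.
- by exists 0; rewrite ?scale0r ?subrr ?normr0 ?lexx ?ler01.
rewrite sub0r dualZ -[- u]scaleN1r !pairing_scalel => FPVu.
exists u, a; split => //.
have [b Bub] := BP u.
have bu : `|b u| <= M * `|u|.
  apply: bM Bub _; exists s; first by rewrite s0 s1.
  by rewrite (lt_le_trans us)// ge_min lexx.
have {}bu : b u <= M * `|u| := le_trans (ler_norm _) bu.
have abu := AB Aua Bub.
set e := u - s *: y in us; have uE : u = s *: y + e by rewrite addrC subrK.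
have fe : - `|e| <= f e by have := f1 e; rewrite ler_norml => /andP[].
have fu : f u = s * `|y| + f e by rewrite uE pairing_addl pairing_scalel fy.
have ue : `|u| <= s * `|y| + `|e|.
  by rewrite uE (le_trans (ler_normD _ _))// normrZ ger0_norm.
have er : `|e| * (2 * M + 2) < r.
  by rewrite -ltr_pdivlMr//; apply: lt_le_trans us _; rewrite ge_min lexx orbT.
have h1 : (M + 1) * f u <= M * `|u| by lra.
have h2 := ler_wpM2l M0 ue.
have M1 : 0 <= M + 1 by lra.
have h3 := ler_wpM2l M1 fe.
rewrite fu in h1; clearbody e; lra.
Qed.

(** This is the domination that [cone_extension] requires. Using Fitzpatrick cones instead of finite
    combinations of graph points leaves a single inequality for [p] and one for [q], each testable
    at any graph point, in particular at those supplied by type (FPV). *)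
Lemma fitzpatrick_dominated (M r : R) : 0 < r -> 0 <= M ->
  (forall v b, `|v| < r -> B v b -> forall x, `|b x| <= M * `|x|) ->
  forall p q, fitzpatrick_cone A p -> fitzpatrick_cone B q ->
  0 <= p.2 + q.2 + M * `|p.1 - q.1|.
Proof.
move=> r0 M0 bM [y S] [w T] [L L0 [a' hA]] [L' L'0 [b' hB]] /=.
rewrite -addrA; set T' := T + M * _.
rewrite /= in hA hB.
have [Ca Ca0 a'C] := dual_normP a'; have [Cb Cb0 b'C] := dual_normP b'.
pose K := `|y| + 1.
have K0 : 0 < K by rewrite ltr_wpDl.
(* Testing the inequality for [q] at [(v, b)] bounds [b w] by [T] up to order [t]; passing from [w]
   to [y] costs the remaining term of [T']. *)
have Bup t v b : 0 < t -> t * K < r -> `|v| <= t * K -> B v b ->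
    b y <= T' + t * (K * (Cb + L' * M)).
  move=> t0 tKr vtK Bvb; have vr := le_lt_trans vtK tKr.
  have := hB _ _ Bvb; have := le_trans (ler_norm _) (bM _ _ vr Bvb (y - w)).
  have := le_trans (ler_norm _) (bM _ _ vr Bvb v).
  have := b'C v; rewrite ler_norml => /andP[+ _].
  have := ler_wpM2l Cb0 vtK; have := ler_wpM2l M0 vtK.
  rewrite pairing_subl /T' => h1 h2 h3 h4 h5 h6.
  have := ler_wpM2l L'0 (le_trans h4 h1).
  lra.
(* The three entries give [t * t <= t], [t * K < r] and [t * L <= 1]. *)
pose t0 := Num.min 1 (Num.min (r / (2 * K)) (L + 1)^-1).
(* The coefficient of [t] collects the errors from [a' u], from [Bup], from [b e] and [b0 e] on a
   tube of radius [t * t], and from [L * b u]. *)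
apply: (@ge0_of_small _ _ (Ca * K + K * (Cb + L' * M) + 2 * M + L * M * K) t0).
  by rewrite !lt_min ltr01 divr_gt0 ?mulr_gt0//= invr_gt0; lra.
move=> t t_gt0; rewrite !le_min => /and3P[t1 tr tL].
have {}tr : t * K < r by move: tr; rewrite ler_pdivlMr ?mulr_gt0//; nra.
have {}tL : 0 <= 1 - t * L.
  by move: tL; rewrite -div1r ler_pdivlMr; lra.
have tt0 : 0 < t * t by rewrite mulr_gt0.
have tyK : `|t *: y| <= t * K.
  by rewrite normrZ gtr0_norm// ler_pM2l// lerDl.
have [b0 Bb0] := BP (t *: y).
have [||u [a [[s /andP[s0 s1] us] Aua]]] := @FPV_witness _ _ A
    (tube (t *: y) (t * t)) (t *: y) (- b0) FA (@tube_open _ _ _ _)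
    (@tube_convex _ _ _ _).
- have [u [a [ut Aua]]] := zero_closure_dom tt0.
  exists u; split; last by exists a.
  by exists 0; rewrite ?scale0r ?subr0 ?lexx ?ler01.
- by exists 1; rewrite ?scale1r ?subrr ?normr0 ?lexx ?ler01.
rewrite dualN !pairing_subl !pairing_scalel => F1.
set e := u - s *: (t *: y) in us.
have uE : u = s *: (t *: y) + e by rewrite addrC subrK.
clearbody e.
have uK : `|u| <= t * K.
  rewrite uE (le_trans (ler_normD _ _))// !normrZ (ger0_norm s0) (gtr0_norm t_gt0).
  have := normr_ge0 y; rewrite /K; move: `|y| `|e| us => n m us n0.
  have := mulr_ge0 (ltW t_gt0) n0 => tn.
  have : t * t <= t * 1 by rewrite ler_pM2l.
  have : s * (t * n) <= 1 * (t * n) by rewrite ler_wpM2r.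
  lra.
have [b Bub] := BP u.
have ur := le_lt_trans uK tr.
have yr := le_lt_trans tyK tr.
have F2 : a y <= S + Ca * (t * K) + L * a u.
  have := hA _ _ Aua; have := a'C u; rewrite ler_norml => /andP[+ _].
  have := ler_wpM2l Ca0 uK; lra.
have F3 := AB Aua Bub.
have F40 := Bup t (t *: y) b0 t_gt0 tr tyK Bb0.
have F41 := Bup t u b t_gt0 tr uK Bub.
have F50 : b0 u = s * (t * b0 y) + b0 e.
  by rewrite {1}uE pairing_addl !pairing_scalel.
have F51 : b u = s * (t * b y) + b e.
  by rewrite {1}uE pairing_addl !pairing_scalel.
have eM := ler_wpM2l M0 (ltW us).
have be : b e <= M * (t * t).
  exact: le_trans (le_trans (ler_norm _) (bM _ _ ur Bub e)) eM.
have b0e : - (M * (t * t)) <= b0 e.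
  have := le_trans (bM _ _ yr Bb0 e) eM.
  by rewrite ler_norml => /andP[].
have F6 : - (M * (t * K)) <= b u.
  have := le_trans (bM _ _ ur Bub u) (ler_wpM2l M0 uK).
  by rewrite ler_norml => /andP[].
clear uE hA hB Bup bM a'C b'C tyK uK ur yr us eM.
have s1' : 0 <= 1 - s by rewrite subr_ge0.
(* The factor [1 - t * L] absorbs the term [L * a u] of [F2]. By [F1], what remains of [B] is
   [(1 - s) * t * b0 y + s * t * b y] up to order [t * t], a convex combination to which [Bup]
   applies twice. The goal is then multiplied by [t]. *)
have G1 := mulr_ge0 tL F3.
have G2 := ler_wpM2l (ltW t_gt0) F2.
have G3 := ler_wpM2l (mulr_ge0 s1' (ltW t_gt0)) F40.
have G4 := ler_wpM2l (mulr_ge0 s0 (ltW t_gt0)) F41.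
have G5 := ler_wpM2l (mulr_ge0 (ltW t_gt0) L0) F6.
rewrite -(pmulr_rge0 _ t_gt0).
lra.
Qed.

(** One extension serves both operators: [D] contains [(u, - a u)] and [(- w, - b w)], and [c] lies
    above [D]. The conclusions say that [(0, - c)] and [(0, c)] are monotonically related to [A] and
    [B]. *)
Lemma common_functional : exists c : dual X,
  (forall u a, A u a -> 0 <= (a u : R) + c u) /\
  (forall w b, B w b -> c w <= b w).
Proof.
have [r r0 [M M0 bM]] := tube_bounded 0 mB dB.
have {}bM v b : `|v| < r -> B v b -> forall x, `|b x| <= M * `|x|.
  move=> vr; apply: bM.
  by exists 0; rewrite ?scale0r ?subr0 ?lexx ?ler01.
have [A00 AD AZ] := fitzpatrick_cone_convex A.
have [B00 BD BZ] := fitzpatrick_cone_convex B.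
pose D := [set p : X * R^o | exists d e, [/\ fitzpatrick_cone A d,
  fitzpatrick_cone B e & p = (d.1 - e.1, - (d.2 + e.2))]].
have cD : convex_cone D.
  split.
  - by exists 0, 0; split=> //; rewrite /= subrr addr0 oppr0.
  - move=> _ _ [d [e [Ad Be ->]]] [d' [e' [Ad' Be' ->]]].
    exists (d + d'), (e + e'); split; [exact: AD|exact: BD|].
    by congr pair; rewrite /= ?opprD addrACA// opprD addrACA.
  - move=> k _ k0 [d [e [Ad Be ->]]].
    exists (k *: d), (k *: e); split; [exact: AZ|exact: BZ|].
    by congr pair; rewrite /= ?scalerN ?scalerBr ?scalerDr.
have DM p : D p -> p.2 <= M * `|p.1|.
  move=> [d [e [Ad Be ->]]] /=; rewrite lerNl -subr_ge0 opprK.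
  exact: fitzpatrick_dominated r0 M0 bM _ _ Ad Be.
have [c _ cD0] := cone_extension M0 cD DM.
exists c; split=> [u a Aua|w b Bwb].
  have /cD0 : D (u - 0, - ((a u : R^o) + 0)).
    by exists (u, a u), 0; split => //; exact: gra_fitzpatrick_cone.
  by rewrite /= subr0 addr0; lra.
have /cD0 : D (0 - w, - (0 + (b w : R^o))).
  by exists 0, (w, b w); split => //; exact: gra_fitzpatrick_cone.
by rewrite /= sub0r add0r -[- w]scaleN1r pairing_scalel; lra.
Qed.

End sum.

(** * Maximality of the sum *)

Lemma maximal_monotoneP (R : realType) (X : normedModType R)
    (A : X -> set (dual X)) x (x' : dual X) :
  maximal_monotone A ->
  (forall y y', A y y' -> 0 <= pairing (x - y) (x' - y')) -> A x x'.
Proof.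
move=> [mA maxA] h; apply: contrapT => nA.
pose C v := A v `|` [set v' | v = x /\ v' = x'].
have pC u v (f g : dual X) : pairing (u - v) (f - g) = pairing (v - u) (g - f).
  by rewrite !pairingBr !pairing_subl; lra.
apply: (maxA C).
  move=> u v f g [Af|[ux fx]] [Ag|[vx gx]].
  - exact: mA.
  - by rewrite (vx : v = x) (gx : g = x') pC; exact: h.
  - by rewrite (ux : u = x) (fx : f = x'); exact: h.
  - by rewrite (ux : u = x) (vx : v = x) subrr /pairing linear0.
split; first by move=> [u f] Af; left.
by move=> CA; apply/nA/(CA (x, x')); right.
Qed.

Theorem corollary3p6 (R : realType) (X : completeNormedModType R)
    (A B : X -> set (dual X)) :
  maximal_monotone A -> type_FPV A ->
  maximal_monotone B -> dom B = [set: X] ->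
  maximal_monotone (op_add A B).
Proof.
move=> MA FA MB dB; have [mA _] := MA; have [mB _] := MB.
split.
  move=> x y x' y' [a Aa [b Bb abx]] [a' Aa' [b' Bb' aby]].
  rewrite -(abx : a + b = x') -(aby : a' + b' = y').
  have := mA x y a a' Aa Aa'; have := mB x y b b' Bb Bb'.
  by rewrite !pairingBr !dualD; lra.
move=> C mC [ABC nCAB]; apply: nCAB => -[z z'] /= Czz'.
pose A' u := A (z + u).
(* The shift by [z'] is put wholly on [B], so that [(z, z')] becomes [(0, 0)] for the sum of [A']
   and [B']. *)
pose B' u := [set b : dual X | B (z + u) (b + z')].
have zE v : z + (v - z) = v by rewrite addrC subrK.
have zK (u v : X) : z + u - (z + v) = u - v by rewrite opprD addrACA subrr add0r.
have [||||||c [Ac Bc]] := @common_functional _ _ A' B'.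
- exact: type_FPV_translate.
- by move=> u v a b Aa Ab; have := mA (z + u) (z + v) a b Aa Ab; rewrite zK.
- have [v [a Ava]] : dom A !=set0.
    (* With an empty domain [(0, 0)] would be vacuously related to [A], hence in its graph by
       maximality. *)
    have [//|h] := pselect (dom A !=set0); exists 0, 0.
    apply: (maximal_monotoneP MA) => y y' Ayy'.
    by case: h; exists y, y'.
  by exists (v - z), a; rewrite /A' zE.
- move=> u v a b Ba Bb; have := mB (z + u) (z + v) (a + z') (b + z') Ba Bb.
  by rewrite zK !pairingBr !dualD; lra.
- apply/seteqP; split=> // u _; have : dom B (z + u) by rewrite dB.
  by move=> [b Bb]; exists (b - z'); rewrite /B' /= subrK.
- move=> u a b Aa Bb.
  have /ABC Cu : gra (op_add A B) (z + u, a + (b + z')).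
    by exists a => //; exists (b + z').
  have := mC _ _ _ _ Cu Czz'; rewrite pairingBr !dualD [z + u - z]addrAC subrr add0r.
  lra.
(* The decomposition is [z' = - c + (c + z')]; maximality of [A] and of [B] places the summands in
   [A z] and [B z]. *)
exists (- c); last exists (c + z'); last by rewrite addKr.
  apply: (maximal_monotoneP MA) => y a Aya.
  have := Ac (y - z) a; rewrite /A' zE => /(_ Aya) h.
  rewrite -[leRHS]/(- c (z - y) - a (z - y)).
  by move: h; rewrite !pairing_subl; lra.
apply: (maximal_monotoneP MB) => y b Byb.
have := Bc (y - z) (b - z'); rewrite /B' /= subrK zE => /(_ Byb) h.
rewrite -[leRHS]/(c (z - y) + z' (z - y) - b (z - y)).
by move: h; rewrite -[leRHS]/(b (y - z) - z' (y - z)) !pairing_subl; lra.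
Qed.
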